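(* Let $\mu$ be a strict partition. Then for every integer $n\ge0$, $$\sum_{|\lambda/\mu|=n}\frac{2^{|\lambda|-\ell(\lambda)-|\mu|+\ell(\mu)}f_{\lambda/\mu}H_\mu}{H_{\lambda}}\Bigl(\sum_{\square\in\lambda}\binom{c_{\square}}{2}-\sum_{\square\in\mu}\binom{c_{\square}}{2}\Bigr)=\binom{n}{2}+n|\mu|,$$ where the sum ranges over all strict partitions $\lambda\supseteq\mu$ with $|\lambda|-|\mu|=n$.
   Context: A strict partition is a finite strictly decreasing sequence of positive integers $\lambda=(\lambda_1>\lambda_2>\cdots>\lambda_\ell)$ (the empty sequence $\emptyset$ is allowed); $|\lambda|=\sum_i\lambda_i$ is its size, $\ell(\lambda)=\ell$ its length, and $\lambda_i=0$ for $i>\ell(\lambda)$. The (shifted Young) diagram of $\lambda$ is the set of boxes $(i,j)$ with $1\le i\le \ell(\lambda)$ and $i+1\le j\le i+\lambda_i$ (row $i$, column $j$); $\lambda$ is identified with its diagram. The content of a box $\square=(i,j)$ is $c_\square=j-i$. The hook length $h_\square$ of $\square=(i,j)\in\lambda$ is the number of boxes of $\lambda$ in row $i$ strictly to the right of $\square$, plus the number of boxes $(i',j)\in\lambda$ with $i'>i$, plus $1$, plus $\lambda_j$. $H_\lambda=\prod_{\square\in\lambda}h_\square$ ($H_\emptyset=1$). For strict partitions write $\lambda\supseteq\mu$ if $\lambda_i\ge\mu_i$ for all $i$; then $\lambda/\mu$ denotes the set of boxes of $\lambda$ not in $\mu$, and $|\lambda/\mu|=|\lambda|-|\mu|$. $f_{\lambda/\mu}$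 is the number of standard shifted Young tableaux of shape $\lambda/\mu$, i.e. bijective fillings of the boxes of $\lambda/\mu$ with $1,\dots,|\lambda/\mu|$ increasing from left to right along rows and from top to bottom along columns ($f_{\mu/\mu}=1$). *)

(* Defs.v *)
From mathcomp Require Import all_boot all_order all_algebra all_fingroup.
Set Implicit Arguments. Unset Strict Implicit. Unset Printing Implicit Defensive.
Import Order.TTheory GRing.Theory Num.Theory.

Definition part (la : seq nat) (i : nat) : nat := nth 0 la i.-1.  (* 1-indexed; 0 beyond length *)

Definition strict (la : seq nat) : bool := sorted gtn la && all (fun x => 0 < x) la.

Definition psize (la : seq nat) : nat := sumn la.

Definition in_diag (la : seq nat) (b : nat * nat) : bool :=
  [&& 1 <= b.1, b.1 <= size la, b.1.+1 <= b.2 & b.2 <= b.1 + part la b.1].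

Definition boxes (la : seq nat) : seq (nat * nat) :=
  [seq (i, j) | i <- iota 1 (size la), j <- iota i.+1 (part la i)].

Definition content (b : nat * nat) : nat := b.2 - b.1.

Definition hook (la : seq nat) (b : nat * nat) : nat :=
  let: (i, j) := b in
  (i + part la i - j)
  + count (fun i' => in_diag la (i', j)) (iota i.+1 (size la))
  + 1 + part la j.

Definition Hprod (la : seq nat) : nat := \prod_(b <- boxes la) hook la b.

Definition contains (la mu : seq nat) : bool :=
  all (fun i => part mu i <= part la i) (iota 1 (size mu)).

Definition skew_boxes (la mu : seq nat) : seq (nat * nat) :=
  [seq b <- boxes la | ~~ in_diag mu b].

(* a bijective filling of the k boxes of la/mu with 1..k, given by sigma: box t gets (sigma t).+1 *)
Definition standard_filling (la mu : seq nat) (s : {perm 'I_(size (skew_boxes la mu))}) : bool :=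
  [forall t : 'I_(size (skew_boxes la mu)), forall u : 'I_(size (skew_boxes la mu)),
     let bt := nth (0,0) (skew_boxes la mu) t in
     let bu := nth (0,0) (skew_boxes la mu) u in
     ((bt.1 == bu.1) && (bt.2 < bu.2)) || ((bt.2 == bu.2) && (bt.1 < bu.1))
     ==> (s t < s u)].

Definition nSYT (la mu : seq nat) : nat :=
  #|[set s : {perm 'I_(size (skew_boxes la mu))} | standard_filling s]|.

Definition part_of_set (m : nat) (A : {set 'I_m.+1}) : seq nat :=
  sort geq [seq val x | x <- enum A].

Definition sum_binom_content (la : seq nat) : nat :=
  \sum_(b <- boxes la) 'C(content b, 2).

Local Open Scope ring_scope.

Definition summand (la mu : seq nat) : rat :=
  ((2%:Q) ^ ((psize la)%:Z - (size la)%:Z - (psize mu)%:Z + (size mu)%:Z))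
  * (nSYT la mu)%:R * (Hprod mu)%:R / (Hprod la)%:R
  * ((sum_binom_content la)%:R - (sum_binom_content mu)%:R).

(* Sum over all strict partitions la ⊇ mu with |la| - |mu| = n.  Every strict
   partition of size m has distinct parts in {1..m}, so it is encoded (bijectively)
   by its set of parts A ⊆ {0..m}. *)
Definition skew_sum (mu : seq nat) (n : nat) : rat :=
  \sum_(A : {set 'I_(psize mu + n).+1} |
          strict (part_of_set A) && (psize (part_of_set A) == psize mu + n)%N
          && contains (part_of_set A) mu)
     summand (part_of_set A) mu.

(* Main.v *)
(* Write f for the number of standard tableaux.  Removing the box with the
   smallest entry gives f(la/mu) = sum of f(la/mu+) over the strict partitions
   mu+ inside la that add one box to mu.  Induction on n thus reduces the theorem
   to two one-step identities for the weights u = 2^(1 - l(mu+) + l(mu)) H(mu)/H(mu+):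
   the sum of u over mu+ is 1, and the sum of u * binom(c, 2), where c is the
   content of the added box, is |mu|.

   By the product formula H(mu) = prod_x x! * prod_(x > y) (x + y)/(x - y) over the
   parts of mu, the weight of x -> x + 1 is Res_x / (x(x+1)), where Res_x is the
   residue at t = x(x+1) of F(t) = prod_y (t - y(y-1)) / (t - y(y+1)), and the weight
   of a new part 1 is F(0).  The first identity is the partial fraction expansion of
   F at t = 0; the second one, as binom(x+1, 2) = x(x+1)/2, compares the coefficients
   of 1/t at infinity: the sum of Res_x is sum_y (y(y+1) - y(y-1)) = 2|mu|. *)
Require Import Defs.
From mathcomp Require Import all_boot all_order all_algebra all_fingroup.
From mathcomp Require Import zify ring lra.
Set Implicit Arguments. Unset Strict Implicit. Unset Printing Implicit Defensive.
Import Order.TTheory GRing.Theory Num.Theory.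

(** * Linear extensions *)

Section LinearExtensions.
Variables (T : eqType) (r : rel T).

(** Orderings of [s] in which nothing comes after an element that it must precede. The relation need
    not be transitive: for tableaux it compares only boxes of one row or one column. *)
Definition linext (s : seq T) : nat :=
  count (pairwise (fun x y => ~~ r y x)) (permutations s).

Lemma perm_linext s t : perm_eq s t -> linext s = linext t.
Proof. by move=> /perm_permutations /seq.permP; apply. Qed.

(** Split by the first element [x] of the ordering: it may stand first when nothing else must
    precede it, and the tail is then any linear extension of the rest. *)
Lemma linext_rec s : uniq s -> 0 < size s ->
  linext s = \sum_(x <- s | all (fun y => ~~ r y x) (rem x s)) linext (rem x s).
Proof.
move=> us s0; rewrite /linext (seq.permP (permutationsE s0)) undup_id //.
rewrite count_flatten sumnE !big_map [RHS]big_mkcond.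
apply: eq_big_seq => x xs; rewrite count_map.
case: ifP => [allx|nallx].
  apply: eq_in_count => t; rewrite mem_permutations => /perm_all pt /=.
  by rewrite pt allx.
rewrite -[RHS](count_pred0 (permutations (rem x s))); apply: eq_in_count => t.
by rewrite mem_permutations => /perm_all pt /=; rewrite pt nallx.
Qed.

(* The list of a linear extension is read off the inverse of the labelling. *)
Lemma card_labellings (x0 : T) (s : seq T) : irreflexive r -> uniq s ->
  #|[set p : {perm 'I_(size s)} | [forall t : 'I_(size s), forall u : 'I_(size s),
       r (nth x0 s t) (nth x0 s u) ==> (p t < p u)]]| = linext s.
Proof.
move=> r_irr us.
pose f (p : {perm 'I_(size s)}) : seq T :=
  [tuple tnth (in_tuple s) ((p^-1)%g i) | i < size s].
have fE p (i : 'I_(size s)) : nth x0 (f p) i = nth x0 s ((p^-1)%g i).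
  by rewrite /f (nth_map i) ?size_enum_ord // nth_ord_enum (tnth_nth x0).
have f_inj : injective f.
  move=> p q /= fpq; apply: invg_inj; apply/permP => i; apply: val_inj => /=.
  have := fE p i; rewrite fpq fE => /eqP.
  by rewrite nth_uniq // => /eqP.
rewrite /linext cardE -(size_map f) -size_filter; apply/perm_size/uniq_perm.
- by rewrite map_inj_uniq // enum_uniq.
- by rewrite filter_uniq // permutations_uniq.
move=> l; rewrite mem_filter mem_permutations.
have stdE p : pairwise (fun x y => ~~ r y x) (f p) = (p \in
   [set p : {perm 'I_(size s)} | [forall t : 'I_(size s), forall u : 'I_(size s),
       r (nth x0 s t) (nth x0 s u) ==> (p t < p u)]]).
  have szf : size (f p) = size s by rewrite size_tuple.
  rewrite inE; apply/(pairwiseP x0)/forallP => [H t|H i j].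
    apply/forallP => u; apply/implyP => rtu; rewrite ltnNge; apply/negP => pu_le.
    have := H (p u) (p t); rewrite !inE szf !ltn_ord !fE !permK rtu.
    move: pu_le; rewrite leq_eqVlt => /predU1P[/val_inj/perm_inj ut|->].
      by rewrite ut r_irr in rtu.
    by move/(_ isT isT isT).
  rewrite !inE szf => li lj ij.
  rewrite (fE p (Ordinal li)) (fE p (Ordinal lj)).
  have /forallP/(_ ((p^-1)%g (Ordinal li))) := H ((p^-1)%g (Ordinal lj)).
  by rewrite !permKV; apply: contraTN => /= ->; rewrite -leqNgt ltnW.
apply/mapP/andP => [[p + ->]|[pl]].
  rewrite mem_enum -stdE; split=> //.
  rewrite -[s in perm_eq _ s]/(val (in_tuple s)); apply/tuple_permP.
  by exists (p^-1)%g.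
rewrite -[s in perm_eq l s]/(val (in_tuple s)) => /tuple_permP[q lq].
exists (q^-1)%g; last by rewrite lq /f invgK.
by rewrite mem_enum -stdE /f invgK -lq.
Qed.
End LinearExtensions.

(** * Shifted diagrams *)

Lemma part_default la i : size la < i -> part la i = 0.
Proof. by move=> h; rewrite /part nth_default //; lia. Qed.

Lemma part_pos la i : strict la -> 0 < i -> (0 < part la i) = (i <= size la).
Proof.
case/andP=> _ /allP pos i0; have [il|il] := leqP i (size la).
  by apply/pos/mem_nth; rewrite prednK.
by rewrite part_default.
Qed.

(** At [i = size la] the left side of the inequality is the default 0, so the one chain of
    inequalities also carries the positivity of the parts. *)
Lemma strictP la : reflect
  (forall i, 0 < i <= size la -> part la i.+1 < part la i) (strict la).
Proof.
apply: (iffP idP) => [st [//|i] /andP[_ il]|H].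
  have [il'|il'] := ltnP i.+1 (size la).
    by case/andP: st => /(sortedP 0)/(_ i il').
  by rewrite part_default ?part_pos.
apply/andP; split.
  by apply/(sortedP 0) => i il; apply: (H i.+1); rewrite /= ltnW.
by apply/(all_nthP 0) => i il; apply: leq_trans (H i.+1 _).
Qed.

Lemma part_anti la i j : strict la -> 0 < i -> i <= j -> j <= size la ->
  part la j + (j - i) <= part la i.
Proof.
move=> /strictP st i0; elim: j => [|j IH] ij jl; first lia.
have [<-|ij'] := eqVneq i j.+1; first by rewrite subnn addn0.
have := st j; lia.
Qed.

Lemma part_incr la i j : 0 < j -> part (incr_nth la i) j = (i.+1 == j) + part la j.
Proof. by case: j => // j _; rewrite /part nth_incr_nth. Qed.

Lemma mem_boxes la b : (b \in boxes la) = in_diag la b.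
Proof.
case: b => i j; rewrite /in_diag /=; apply/allpairsPdep/idP.
  case=> x [y] []; rewrite !mem_iota => H1 H2 [-> ->]; lia.
by move=> H; exists i, j; rewrite !mem_iota; split=> //; lia.
Qed.

Lemma boxes_uniq la : uniq (boxes la).
Proof.
apply: allpairs_uniq_dep => [|x _|]; try exact: iota_uniq.
by move=> [x1 x2] [y1 y2] _ _ /= [-> ->].
Qed.

(** Here [i] counts from 0, as in [incr_nth], while rows of the diagram count from 1; [i = size la]
    opens a new row. *)
Definition new_box (la : seq nat) (i : nat) : nat * nat :=
  (i.+1, i.+1 + (part la i.+1).+1).

Lemma in_diag_incr la i b : strict la -> i <= size la ->
  in_diag (incr_nth la i) b = (b == new_box la i) || in_diag la b.
Proof.
case: b => x y st il; rewrite /in_diag /new_box xpair_eqE /= size_incr_nth.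
have [x0|x0] := posnP x; first by rewrite x0 /=; lia.
rewrite part_incr //.
have xl : size la < x -> part la x = 0 by apply: part_default.
by have [ix|ix] := eqVneq i.+1 x; [subst x|]; case: ifP; lia.
Qed.

Lemma new_box_notin la i : in_diag la (new_box la i) = false.
Proof. rewrite /in_diag /new_box /=; lia. Qed.

Lemma perm_boxes_incr la i : strict la -> i <= size la ->
  perm_eq (boxes (incr_nth la i)) (new_box la i :: boxes la).
Proof.
move=> st il; apply: uniq_perm; first exact: boxes_uniq.
  by rewrite /= mem_boxes new_box_notin boxes_uniq.
by move=> b; rewrite inE !mem_boxes in_diag_incr.
Qed.

Lemma size_boxes la : size (boxes la) = psize la.
Proof.
rewrite /boxes size_allpairs_dep /psize; congr sumn.
apply: (@eq_from_nth _ 0); rewrite size_map size_iota // => i il.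
by rewrite (nth_map 0) ?size_iota // nth_iota // size_iota.
Qed.

Lemma psize_incr la i : strict la -> i <= size la ->
  psize (incr_nth la i) = (psize la).+1.
Proof.
by move=> st il; rewrite -!size_boxes (perm_size (perm_boxes_incr st il)).
Qed.

Lemma sum_binom_content_incr la i : strict la -> i <= size la ->
  sum_binom_content (incr_nth la i)
  = 'C((part la i.+1).+1, 2) + sum_binom_content la.
Proof.
move=> st il; rewrite /sum_binom_content (perm_big _ (perm_boxes_incr st il)).
by rewrite big_cons /content /new_box /= addKn.
Qed.

Lemma containsP la mu : reflect (forall i, 0 < i -> part mu i <= part la i)
  (contains la mu).
Proof.
apply: (iffP allP) => H i; last by rewrite mem_iota => ?; apply: H; lia.
move=> i0; have [im|im] := leqP i (size mu); first by apply: H; rewrite mem_iota; lia.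
by rewrite part_default.
Qed.

Lemma contains_size la mu : strict la -> strict mu -> contains la mu ->
  size mu <= size la.
Proof.
move=> sl sm /containsP H; case E: (size mu) => [//|k].
by rewrite -part_pos // (leq_trans _ (H _ _)) // part_pos // E.
Qed.

Lemma in_diag_contains la mu b : strict la -> strict mu -> contains la mu ->
  in_diag mu b -> in_diag la b.
Proof.
move=> sl sm c; have := contains_size sl sm c; move/containsP: c => H.
case: b => x y; rewrite /in_diag /=; have := H x; lia.
Qed.

Lemma mem_skew_boxes la mu b :
  (b \in skew_boxes la mu) = in_diag la b && ~~ in_diag mu b.
Proof. by rewrite mem_filter mem_boxes andbC. Qed.

Lemma skew_boxes_uniq la mu : uniq (skew_boxes la mu).
Proof. by rewrite filter_uniq ?boxes_uniq. Qed.

Lemma perm_skew_boxes_incr la mu i : strict mu -> i <= size mu ->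
  perm_eq (skew_boxes la (incr_nth mu i)) (rem (new_box mu i) (skew_boxes la mu)).
Proof.
move=> sm im; apply: uniq_perm; rewrite ?rem_uniq ?skew_boxes_uniq // => b.
rewrite mem_rem_uniq ?skew_boxes_uniq // !inE !mem_skew_boxes in_diag_incr //.
by rewrite negb_or; case: eqP; rewrite ?andbF.
Qed.

(** * Standard shifted tableaux and addable boxes *)

Definition before (b c : nat * nat) : bool :=
  ((b.1 == c.1) && (b.2 < c.2)) || ((b.2 == c.2) && (b.1 < c.1)).

Lemma nSYT_linext la mu : nSYT la mu = linext before (skew_boxes la mu).
Proof.
rewrite -(card_labellings (0, 0)) ?skew_boxes_uniq //.
by move=> x; rewrite /before !ltnn !andbF.
Qed.

(** Lengthening a row can only violate the comparison with the row above it. *)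
Lemma strict_incr mu i : strict mu -> i <= size mu ->
  strict (incr_nth mu i) = (i == 0) || ((part mu i.+1).+1 < part mu i).
Proof.
move=> sm im; apply/strictP/idP => [H|H j /andP[j0 jm]].
  case: i im H => // i im /(_ i.+1); rewrite !part_incr // size_incr_nth.
  by rewrite eqxx; case: ifP; lia.
rewrite !part_incr //; have [jm'|jm'] := leqP j (size mu).
  have /strictP/(_ j) := sm; rewrite eqSS.
  by case: (eqVneq i j) => [ij|]; [subst j; lia|case: eqP; lia].
rewrite !part_default // ?eqSS; last lia.
by move: jm; rewrite size_incr_nth; case: ifP; lia.
Qed.

(** A box of the skew shape is minimal when its left and upper neighbours, if they lie in [la],
    already lie in [mu]; these are exactly the boxes whose addition to [mu] gives a strict partition
    inside [la]. *)
Lemma minimal_boxes la mu : strict la -> strict mu -> contains la mu ->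
  perm_eq [seq b <- skew_boxes la mu
             | all (fun c => ~~ before c b) (rem b (skew_boxes la mu))]
          [seq new_box mu i | i <- iota 0 (size mu).+1
             & strict (incr_nth mu i) && contains la (incr_nth mu i)].
Proof.
move=> sl sm c; apply: uniq_perm.
- by rewrite filter_uniq ?skew_boxes_uniq.
- by rewrite map_inj_uniq ?filter_uniq ?iota_uniq // => i j [].
have cs := contains_size sl sm c; move/containsP: (c) => cP.
(* No box precedes itself, so removing [b] from the list does not matter. *)
have minE b : all (fun c => ~~ before c b) (rem b (skew_boxes la mu))
   = all (fun c => ~~ before c b) (skew_boxes la mu).
  have [bs|bs] := boolP (b \in skew_boxes la mu); last by rewrite rem_id.
  rewrite (perm_all _ (perm_to_rem bs)) /= /before.
  by rewrite !ltnn !andbF.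
set I := [seq i <- _ | _ && _].
have memI i : (i \in I) = [&& i <= size mu, strict (incr_nth mu i) &
    contains la (incr_nth mu i)].
  by rewrite mem_filter mem_iota andbC.
move=> [x y]; rewrite mem_filter minE mem_skew_boxes.
apply/andP/mapP => [[/allP min /andP[inl nim]]|[i + [-> ->]]].
  have minl : in_diag la (x, y.-1) -> 0 < y -> in_diag mu (x, y.-1).
    move=> h y0; apply: contraT => h'.
    have := min (x, y.-1); rewrite mem_skew_boxes h h' /before /= => /(_ isT); lia.
  have minu : in_diag la (x.-1, y) -> 0 < x -> in_diag mu (x.-1, y).
    move=> h y0; apply: contraT => h'.
    have := min (x.-1, y); rewrite mem_skew_boxes h h' /before /= => /(_ isT); lia.
  move: inl nim minl minu; rewrite /in_diag /=.
  move=> inl nim minl minu.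
  (* In the first row the left neighbour alone fixes the column. *)
  have [x1|x1] := leqP x 1.
    have xE : x = 1 by lia.
    subst x.
    have yE : y = (part mu 1).+2.
      have [m0|m0] := posnP (size mu).
        have := @part_default mu 1; lia.
      lia.
    exists 0; last by rewrite /new_box yE.
    rewrite memI strict_incr //=.
    apply/containsP => j j0; rewrite part_incr //; have := cP j j0.
    case: eqP => [<-|]; lia.
  (* By strictness of [la] the upper neighbour lies in [la], hence in [mu]; so row [x - 1] of [mu]
     exceeds row [x] by at least 2. *)
  have lax := part_anti sl (i := x.-1) (j := x).
  have xm : x <= (size mu).+1 by lia.
  have dx : size mu < x -> part mu x = 0 by apply: part_default.
  have sx : (part mu x).+1 < part mu x.-1 by lia.
  exists x.-1; last by rewrite /new_box prednK; [congr (_, _)|]; lia.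
  have xm' : x.-1 <= size mu by lia.
  rewrite memI xm' strict_incr // prednK ?sx ?orbT /=; last lia.
  apply/containsP => j j0.
  rewrite part_incr //; have := cP j j0; rewrite prednK; last lia.
  by case: eqP => [<-|]; lia.
rewrite memI => /and3P[im si ci].
rewrite -/(new_box mu i) new_box_notin /=.
have inl : in_diag la (new_box mu i).
  apply: (in_diag_contains sl si ci).
  by rewrite in_diag_incr ?eqxx.
split; last by rewrite inl.
apply/allP => -[x' y']; rewrite mem_skew_boxes /before /new_box /in_diag /=.
move: si; rewrite strict_incr // => si /andP[h1 h2].
have di : size mu < i.+1 -> part mu i.+1 = 0 by apply: part_default.
apply/negP => /orP[] /andP[/eqP]; first by move=> ?; subst x'; lia.
move=> ? h3; subst y'.
(* A box above the new one in its column already lies in [mu], since the rows of [mu] above reach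
   that column. *)
case/orP: si => [/eqP i0|si]; first lia.
have := part_anti sm (i := x') (j := i); lia.
Qed.

Lemma nSYT_rec la mu : strict la -> strict mu -> contains la mu ->
  psize mu < psize la ->
  nSYT la mu = \sum_(0 <= i < (size mu).+1
       | strict (incr_nth mu i) && contains la (incr_nth mu i))
     nSYT la (incr_nth mu i).
Proof.
move=> sl sm c lt; rewrite nSYT_linext linext_rec ?skew_boxes_uniq //; last first.
  (* With an empty skew shape every box of [la] would lie in [mu], against the sizes. *)
  rewrite lt0n size_eq0; apply/eqP => s0.
  suff: size (boxes la) <= size (boxes mu) by rewrite !size_boxes leqNgt lt.
  apply: uniq_leq_size; first exact: boxes_uniq.
  move=> b bl; apply/contraT => bm.
  have: b \in skew_boxes la mu by rewrite mem_filter bl -mem_boxes bm.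
  by rewrite s0.
rewrite -big_filter (perm_big _ (minimal_boxes sl sm c)) big_map big_filter.
rewrite [RHS]big_seq_cond [LHS]big_seq_cond /index_iota subn0.
apply: eq_bigr => i /andP[+ _]; rewrite mem_iota => im.
by rewrite nSYT_linext; apply/esym/perm_linext/perm_skew_boxes_incr.
Qed.

Lemma nSYT_id mu : nSYT mu mu = 1.
Proof.
rewrite nSYT_linext.
suff -> : skew_boxes mu mu = [::] by [].
rewrite /skew_boxes -(filter_pred0 (boxes mu)); apply: eq_in_filter => b.
by rewrite mem_boxes => ->.
Qed.

(** * The hook product *)

Definition column (s : seq nat) (j : nat) : nat :=
  count (fun i => in_diag s (i, j)) (iota 1 (size s)).

(** Row [i] starts at column [i + 1], so deleting the first row shifts the rest by one along the
    diagonal. *)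
Lemma in_diag_cons x s i j : 0 < i -> in_diag (x :: s) (i.+1, j.+1) = in_diag s (i, j).
Proof. by case: i => // i _; rewrite /in_diag /part /=; lia. Qed.

Lemma column_cons x s j : column (x :: s) j.+2 = (j < x) + column s j.+1.
Proof.
rewrite /column /=; congr (_ + _).
rewrite -[2]/(1 + 1) iotaDl count_map; apply: eq_in_count => i.
by rewrite mem_iota => /andP[i0 _] /=; rewrite add1n in_diag_cons.
Qed.

Lemma leg_cons x s i j :
  count (fun k => in_diag (x :: s) (k, j.+1)) (iota i.+2 (size (x :: s)))
  = count (fun k => in_diag s (k, j)) (iota i.+1 (size s)).
Proof.
rewrite -[i.+2]/(1 + i.+1) iotaDl count_map -[size (x :: s)]/(size s).+1.
(* The last index of the range lies beyond the last row and counts nothing. *)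
rewrite -[(size s).+1]addn1 iotaD count_cat /= [in_diag (x :: s) _](_ : _ = false) ?addn0.
  by apply: eq_in_count => k; rewrite mem_iota => /andP[k0 _] /=;
    rewrite add1n in_diag_cons //; lia.
by rewrite /in_diag /=; lia.
Qed.

Lemma hook_cons x s i j : 0 < i -> 0 < j ->
  hook (x :: s) (i.+1, j.+1) = hook s (i, j).
Proof. by case: i j => [|i] [|j] // _ _; rewrite /hook leg_cons. Qed.

Lemma hook_first_row x s j :
  hook (x :: s) (1, j.+2) = (x - j.+1) + column s j.+1 + 1 + part s j.+1.
Proof. by rewrite /hook leg_cons. Qed.

(** Strictness makes rows 1 to [j] reach column [j + 1]; the later rows start to the right of it. *)
Lemma column_lt s j : strict s -> j < size s -> column s j.+1 = j.
Proof.
move=> st js; rewrite /column -{1}(subnKC (ltnW js)) iotaD count_cat.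
rewrite (@eq_in_count _ _ predT) => [|i]; last first.
  rewrite mem_iota => ij; have := part_anti st (i := i) (j := j.+1).
  by rewrite /in_diag /=; lia.
rewrite count_predT size_iota (@eq_in_count _ _ pred0) ?count_pred0 ?addn0 // => i.
by rewrite mem_iota /in_diag /=; lia.
Qed.

(** Below a first row of length [x], strictness gives [i + part s i <= x] for every row [i] of
    [s]. *)
Lemma column_ge s x j : strict (x :: s) -> x <= j -> column s j.+1 = 0.
Proof.
move=> st xj; apply/eqP; rewrite eqn0Ngt -has_count; apply/hasPn => i.
rewrite mem_iota => im.
have := part_anti st (i := 1) (j := i.+1) isT isT.
by rewrite /in_diag /part /=; case: i im => //=; lia.
Qed.

Lemma strict_cons x s : strict (x :: s) -> strict s.
Proof. by rewrite /strict /= => /and3P[/path_sorted -> _ ->]. Qed.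

Lemma strict_lt x s : strict (x :: s) -> all (fun y => y < x) s.
Proof.
by case/andP => /= + _; rewrite (path_sortedE (rev_trans ltn_trans)) => /andP[].
Qed.

(** The factors of the two products together rearrange 1, ..., [x]. Putting a part [y] on top of [s]
    keeps, up to an index shift, the factors with [j < y]; the later ones are plain differences, and
    the one lost, at [j = y], reappears as [x - y]. *)
Lemma prod_first_row_tail x s : strict (x :: s) ->
  (\prod_(size s <= j < x) (x - j + column s j.+1)) * \prod_(y <- s) (x - y) = x`!.
Proof.
elim: s x => [|y s IH] x st.
  rewrite big_nil muln1 big_nat_rev fact_prod big_add1 /= add0n !big_nat.
  by apply: eq_bigr => i; rewrite /column /=; lia.
have sty := strict_cons st.
have stx : strict (x :: s).
  move: st; rewrite /strict /= => /and3P[/andP[xy] ps -> /andP[_ ->]].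
  rewrite !andbT; apply: (@path_le _ gtn _ x y) ps => //; apply: rev_trans ltn_trans.
have yx : y < x by have /andP[] := strict_lt st.
have sy : size s < y.
  have := part_anti sty (i := 1) (j := (size s).+1) isT isT (leqnn _).
  have : 0 < part (y :: s) (size s).+1 by rewrite (part_pos sty) /=.
  rewrite {3}/part /=; lia.
have y0 : 0 < y by case/andP: sty => _ /andP[].
rewrite -(IH x stx) big_cons mulnCA mulnA; congr (_ * _).
case: x yx {st stx} => // x yx; rewrite big_add1 /=.
rewrite (big_cat_nat (n := y)) ?(ltnW sy) //=.
rewrite [in RHS](big_cat_nat (n := y)) ?(ltnW sy) ?(ltnW yx) //=.
rewrite mulnCA; congr (_ * _).
  rewrite !big_nat; apply: eq_bigr => j /andP[_ jy].
  by rewrite column_cons jy; lia.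
rewrite big_nat_recl /=; last lia.
rewrite (column_ge sty) // addn0; congr (_ * _); rewrite !big_nat.
apply: eq_bigr => j /andP[yj _].
by rewrite column_cons !(column_ge sty) ?ltnNge ?yj //; lia.
Qed.

(** One step of the product formula for [Hprod], with the denominators multiplied out to stay in
    [nat]. Rows below the first keep their hooks. *)
Lemma Hprod_cons x s : strict (x :: s) ->
  Hprod (x :: s) * \prod_(y <- s) (x - y)
  = x`! * \prod_(y <- s) (x + y) * Hprod s.
Proof.
move=> st; have sx : size s <= x.
  by have := part_anti st (i := 1) (j := (size s).+1) isT isT (leqnn _);
    rewrite {2}/part /=; lia.
have -> : Hprod (x :: s) = (\prod_(0 <= j < x) hook (x :: s) (1, j.+2)) * Hprod s.
  rewrite /Hprod /boxes /= big_cat; congr (_ * _).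
    rewrite big_map -[2]/(2 + 0) iotaDl big_map /index_iota subn0.
    by apply: eq_bigr.
  rewrite -[2]/(1 + 1) !big_allpairs_dep iotaDl big_map !big_seq.
  apply: eq_bigr => i; rewrite mem_iota => /andP[i0 _].
  rewrite -[(1 + i).+1]/(1 + i.+1) iotaDl big_map.
  have -> : part (x :: s) (1 + i) = part s i by case: i i0.
  rewrite !big_seq; apply: eq_bigr => j; rewrite mem_iota => /andP[ij _].
  by rewrite hook_cons //; lia.
rewrite -(prod_first_row_tail st) (big_cat_nat (n := size s)) //=.
have sts := strict_cons st.
(* For [j < size s] the leg is [j], so the hook is [(x - j - 1) + j + 1 + y = x + y] with [y] the
   part of index [j]. *)
have -> : \prod_(0 <= j < size s) hook (x :: s) (1, j.+2) = \prod_(y <- s) (x + y).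
  rewrite [RHS](big_nth 0) !big_nat; apply: eq_bigr => j /andP[_ js].
  by rewrite hook_first_row (column_lt sts js) /part /=; lia.
have -> : \prod_(size s <= j < x) hook (x :: s) (1, j.+2)
    = \prod_(size s <= j < x) (x - j + column s j.+1).
  rewrite !big_nat; apply: eq_bigr => j /andP[sj jx].
  by rewrite hook_first_row [part _ _]part_default //; lia.
ring.
Qed.

Lemma Hprod_gt0 s : 0 < Hprod s.
Proof.
rewrite /Hprod; apply: prodn_gt0 => -[i j].
by rewrite /hook addn1 addSn.
Qed.

Local Open Scope ring_scope.

(** * Partial fractions *)

Section PartialFractions.
Variables (F : fieldType) (I : finType) (a b : I -> F).
Hypothesis a_inj : injective a.

Let size_index_enum : size (index_enum I) = #|I|.
Proof. by rewrite -sum1_size -sum1_card; apply: eq_bigl. Qed.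

Let count_neq i : (count (fun j => j != i) (index_enum I)).+1 = #|I|.
Proof.
by rewrite -sum1_count sum1_card cardC1 prednK //; apply/card_gt0P; exists i.
Qed.

(** The difference of the two sides has degree below the number of points, yet vanishes at all of
    them. *)
Lemma lagrange_interpolation (R : {poly F}) : (size R <= #|I|)%N ->
  R = \sum_i (R.[a i] / \prod_(j | j != i) (a i - a j)) *:
        \prod_(j | j != i) ('X - (a j)%:P).
Proof.
move=> szR; set S := \sum_i _; apply/eqP; rewrite -subr_eq0; apply/eqP.
have szl i : size (\prod_(j | j != i) ('X - (a j)%:P)) = #|I|.
  by rewrite -big_filter size_prod_XsubC size_filter count_neq.
have szRS : (size (R - S)%R <= #|I|)%N.
  rewrite (leq_trans (size_polyD _ _)) ?geq_max ?szR ?size_polyN //=.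
  apply: (leq_trans (size_sum _ _ _)); apply/bigmax_leqP => i _.
  by rewrite (leq_trans (size_scale_leq _ _)) ?szl.
apply/eqP/contraT => nz.
suff /(max_poly_roots nz) : all (root (R - S)) [seq a i | i <- enum I].
  by rewrite map_inj_uniq // enum_uniq size_map -cardE ltnNge szRS => /(_ isT).
apply/allP => _ /mapP[i _ ->].
rewrite rootE hornerD hornerN horner_sum (bigD1 i) //=.
rewrite [X in _ - (_ + X)]big1 => [|j ji]; last first.
  rewrite hornerZ horner_prod [X in _ * X](bigD1 i) ?(eq_sym i) //=.
  by rewrite hornerXsubC subrr mul0r mulr0.
rewrite addr0 hornerZ horner_prod.
under [X in _ * X]eq_bigr do rewrite hornerXsubC.
rewrite divfK ?subrr //; apply/prodf_neq0 => j ji.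
by rewrite subr_eq0 (inj_eq a_inj) eq_sym.
Qed.

(* The residue at a i of prod_j (t - b j) / prod_j (t - a j). *)
Definition residue (i : I) : F :=
  (\prod_j (a i - b j)) / \prod_(j | j != i) (a i - a j).
Let D := \prod_j ('X - (b j)%:P) - \prod_j ('X - (a j)%:P).

Let coefPn_prod (c : I -> F) : (0 < #|I|)%N ->
  (\prod_j ('X - (c j)%:P))`_#|I|.-1 = - \sum_j c j.
Proof.
move=> I0; have := @coefPn_prod_XsubC F [seq c j | j <- index_enum I].
by rewrite size_map size_index_enum -lt0n !big_map; apply.
Qed.

(** [D] is a difference of two monic polynomials of degree [#|I|], so its degree is smaller and
    interpolation applies; at [a i] only the first product survives. Divided by the product of the
    ['X - a j], this is a partial fraction expansion. *)
Let D_interp : D = \sum_i residue i *: \prod_(j | j != i) ('X - (a j)%:P).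
Proof.
have szp (c : I -> F) : size (\prod_j ('X - (c j)%:P)) = #|I|.+1.
  by rewrite size_prod_XsubC size_index_enum.
rewrite [LHS]lagrange_interpolation; last first.
  have: (size D <= #|I|.+1)%N.
    by rewrite /D (leq_trans (size_polyD _ _)) ?size_polyN ?szp ?maxnn.
  rewrite leq_eqVlt ltnS => /predU1P[szD|//]; exfalso.
  have: lead_coef D = 0.
    have mon (c : I -> F) : (\prod_j ('X - (c j)%:P))`_#|I| = 1.
      have /monicP := monic_prod_XsubC (index_enum I) predT c.
      by rewrite lead_coefE szp.
    by rewrite lead_coefE szD coefB !mon subrr.
  by move/eqP; rewrite lead_coef_eq0 => /eqP D0; move: szD; rewrite D0 size_poly0.
apply: eq_bigr => i _; congr (_ / _ *: _).
rewrite hornerD hornerN !horner_prod (bigD1 i (F := fun j => ('X - (a j)%:P).[_])) //=.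
by rewrite hornerXsubC subrr mul0r subr0; apply: eq_bigr => j _; rewrite hornerXsubC.
Qed.

Lemma sum_residues : \sum_i residue i = \sum_i a i - \sum_i b i.
Proof.
(* The coefficient of index [#|I| - 1] is meaningful only for nonempty [I]. *)
have [I0|I0] := posnP #|I|.
  by rewrite !big_pred0 ?subr0 // => i; move: (fintype0 i I0).
have /(congr1 (fun p : {poly F} => p`_#|I|.-1)) := D_interp.
rewrite coefB !coefPn_prod // opprK addrC => ->.
rewrite coef_sum; apply: eq_bigr => i _; rewrite coefZ.
suff -> : (\prod_(j | j != i) ('X - (a j)%:P))`_#|I|.-1 = 1 by rewrite mulr1.
have /monicP := monic_prod_XsubC (index_enum I) (fun j => j != i) a.
rewrite lead_coefE -big_filter size_prod_XsubC size_filter /= => <-.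
by rewrite big_filter -(count_neq i).
Qed.

(** Evaluate [D_interp] at 0 and divide by the product of the [- a i]. *)
Lemma partial_fractions_at0 : (forall i, a i != 0) ->
  \prod_i (b i / a i) + \sum_i residue i / a i = 1.
Proof.
move=> a0; have /(congr1 (fun p : {poly F} => p.[0])) := D_interp.
have nz : \prod_i (- a i) != 0 by apply/prodf_neq0 => i _; rewrite oppr_eq0.
rewrite hornerD hornerN !horner_prod horner_sum.
under eq_bigr do rewrite hornerXsubC sub0r.
under [X in _ - X]eq_bigr do rewrite hornerXsubC sub0r.
have -> : \sum_i (residue i *: \prod_(j | j != i) ('X - (a j)%:P)).[0]
   = - (\sum_i residue i / a i) * \prod_i (- a i).
  rewrite -sumrN mulr_suml; apply: eq_bigr => i _; rewrite hornerZ horner_prod.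
  under eq_bigr do rewrite hornerXsubC sub0r.
  rewrite [in RHS](bigD1 i) //= mulrA; congr (_ * _).
  by rewrite mulNr mulrN opprK divfK.
move=> /(congr1 (fun x => x / \prod_i (- a i))).
rewrite mulfK // mulrBl divff // -prodf_div.
under eq_bigr do rewrite invrN mulrNN.
by move=> /eqP; rewrite subr_eq => /eqP ->; ring.
Qed.

End PartialFractions.

(** * Adding one box *)

Lemma HprodR_neq0 s : (Hprod s)%:R != 0 :> rat.
Proof. by rewrite pnatr_eq0 -lt0n Hprod_gt0. Qed.

Lemma HprodR_cons x s : strict (x :: s) ->
  (Hprod (x :: s))%:R = (x`!)%:R * (\prod_(y <- s) ((x%:R + y%:R) / (x%:R - y%:R)))
     * (Hprod s)%:R :> rat.
Proof.
move=> st; have /(congr1 (fun n => n%:R : rat)) := Hprod_cons st.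
rewrite !natrM !natr_prod prodf_div => E.
have -> : \prod_(y <- s) (x%:R - y%:R) = \prod_(y <- s) (x - y)%N%:R :> rat.
  rewrite !big_seq; apply: eq_bigr => y /(allP (strict_lt st)) yx.
  by rewrite natrB // ltnW.
have -> : \prod_(y <- s) (x%:R + y%:R) = \prod_(y <- s) (x + y)%N%:R :> rat.
  by apply: eq_bigr => y _; rewrite natrD.
have nz : \prod_(y <- s) (x - y)%N%:R != 0 :> rat.
  rewrite prodf_seq_neq0; apply/allP => y /(allP (strict_lt st)) yx /=.
  by rewrite pnatr_eq0; lia.
by apply: (mulIf nz); rewrite E; field.
Qed.

Lemma strict_subseq s t : subseq s t -> strict t -> strict s.
Proof.
move=> st /andP[so po]; rewrite /strict (subseq_sorted (rev_trans ltn_trans) st) //.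
by apply/allP => x /(mem_subseq st)/(allP po).
Qed.

Lemma strict_uniq s : strict s -> uniq s.
Proof. by case/andP=> so _; apply: (sorted_uniq (rev_trans ltn_trans) ltnn so). Qed.

(** Each larger part in front contributes one factor involving [x], with denominator [y - x], when
    it is peeled off. *)
Lemma HprodR_insert s1 x s2 : strict (s1 ++ x :: s2) ->
  (Hprod (s1 ++ x :: s2))%:R = (Hprod (s1 ++ s2))%:R * (x`!)%:R
     * (\prod_(y <- s1) ((x%:R + y%:R) / (y%:R - x%:R)))
     * (\prod_(y <- s2) ((x%:R + y%:R) / (x%:R - y%:R))) :> rat.
Proof.
elim: s1 => [|z s1 IH] st.
  by rewrite /= HprodR_cons // big_nil; ring.
have st' : strict (z :: (s1 ++ s2)).
  by apply: strict_subseq st; rewrite /= eqxx cat_subseq // subseq_cons.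
rewrite !cat_cons HprodR_cons // IH ?(strict_cons st) // [in RHS]HprodR_cons //.
rewrite [in RHS]big_cons !big_cat big_cons /=; ring.
Qed.

Lemma incr_nth_take s i : (i < size s)%N ->
  incr_nth s i = take i s ++ (nth 0%N s i).+1 :: drop i.+1 s.
Proof. by elim: s i => [|x s IH] [|i] //= il; rewrite ?drop0 ?IH. Qed.

Lemma incr_nth_size s : incr_nth s (size s) = rcons s 1%N.
Proof. by elim: s => //= x s ->. Qed.

(** The algebra of [Hprod_ratio_row]: [X] is the part that grows, [p] its factorial, [A] and [B] the
    products over larger and smaller parts before the step, [A'] and [B'] those after it. *)
Lemma ratio_cancel (H p X A B A' B' C1 C2 D1 D2 : rat) :
  H != 0 -> p != 0 -> X != 0 -> X + 1 != 0 ->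
  A / A' = C1 / D1 -> B / B' = C2 / D2 ->
  2 * (H * p * A * B / (H * ((X + 1) * p) * A' * B'))
  = (X * (X + 1) - X * (X - 1)) * (C1 * C2) / (D1 * D2) / (X * (X + 1)).
Proof.
move=> Hn pn Xn X1n EA EB.
have -> : 2 * (H * p * A * B / (H * ((X + 1) * p) * A' * B'))
    = 2 / (X + 1) * (A / A') * (B / B').
  rewrite !invfM; move: (A'^-1) (B'^-1) => u v; field.
  by rewrite X1n pn Hn.
rewrite EA EB !invfM; move: (D1^-1) (D2^-1) => u v; field.
by rewrite X1n Xn.
Qed.

Section Ratios.
Variable mu : seq nat.
Hypothesis mu_strict : strict mu.

Let x (i : 'I_(size mu)) : rat := (nth 0%N mu i)%:R.
Let a i := x i * (x i + 1).
Let b i := x i * (x i - 1).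

Let x_gt0 i : 0 < x i.
Proof. by rewrite ltr0n; have := part_pos (i := i.+1) mu_strict isT; rewrite ltn_ord. Qed.

Let a_neq0 i : a i != 0.
Proof. by have := x_gt0 i; rewrite /a; nra. Qed.

Let a_inj : injective a.
Proof.
move=> i j aij; have xij : x i = x j.
  by have := x_gt0 i; have := x_gt0 j; move: aij; rewrite /a; nra.
apply/val_inj/eqP; move/eqP: xij; rewrite /x eqr_nat.
by rewrite nth_uniq ?strict_uniq.
Qed.

(** The residue matches the hook quotient because [x(x+1) - y(y-1) = (x+y)(x+1-y)] and
    [x(x+1) - y(y+1) = (x-y)(x+1+y)]; the 2 comes from [a i - b i = 2 x i]. *)
Lemma Hprod_ratio_row (i : 'I_(size mu)) : strict (incr_nth mu i) ->
  2 * ((Hprod mu)%:R / (Hprod (incr_nth mu i))%:R) = residue a b i / a i.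
Proof.
move=> si.
have muE : mu = take i mu ++ nth 0%N mu i :: drop i.+1 mu.
  by rewrite -drop_nth ?cat_take_drop.
have iE := incr_nth_take (ltn_ord i).
have prodE (f : nat -> rat) : \prod_(j | j != i) f (nth 0%N mu j)
   = (\prod_(y <- take i mu) f y) * \prod_(y <- drop i.+1 mu) f y.
  rewrite -big_cat /=; have := remE (nth 0%N mu i) mu.
  rewrite index_uniq ?strict_uniq // => <-.
  rewrite rem_filter ?strict_uniq // big_filter (big_nth 0%N) big_mkord.
  by apply: eq_bigl => j /=; rewrite nth_uniq ?strict_uniq.
rewrite /residue (bigD1 i) //=.
have -> : \prod_(j | j != i) (a i - b j)
  = (\prod_(y <- take i mu) ((x i + y%:R) * (x i + 1 - y%:R)))
    * (\prod_(y <- drop i.+1 mu) ((x i + y%:R) * (x i + 1 - y%:R))).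
  rewrite -(prodE (fun y => (x i + y%:R) * (x i + 1 - y%:R))).
  by apply: eq_bigr => j _; rewrite /a /b /x; ring.
have -> : \prod_(j | j != i) (a i - a j)
  = (\prod_(y <- take i mu) ((x i - y%:R) * (x i + 1 + y%:R)))
    * (\prod_(y <- drop i.+1 mu) ((x i - y%:R) * (x i + 1 + y%:R))).
  rewrite -(prodE (fun y => (x i - y%:R) * (x i + 1 + y%:R))).
  by apply: eq_bigr => j _; rewrite /a /x; ring.
rewrite [X in (Hprod X)%:R / _]muE iE !HprodR_insert -?muE -?iE //.
rewrite factS natrM.
set H : rat := (Hprod _)%:R; set p : rat := (_`!)%:R.
have Hn : H != 0 by apply: HprodR_neq0.
have pn : p != 0 by rewrite pnatr_eq0 -lt0n fact_gt0.
have Xn : x i != 0 by rewrite gt_eqF.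
have X1n : x i + 1 != 0 by rewrite gt_eqF // addr_gt0.
have -> : (nth 0%N mu i).+1%:R = x i + 1 by rewrite -natr1.
rewrite -/(x i).
(* For the larger parts both denominators change sign, and the signs cancel in the quotient. *)
have q1 (s : seq nat) :
  (\prod_(y <- s) ((x i + y%:R) / (y%:R - x i)))
    * (\prod_(y <- s) ((x i + 1 + y%:R) / (y%:R - (x i + 1))))^-1
  = (\prod_(y <- s) ((x i + y%:R) * (x i + 1 - y%:R)))
    * (\prod_(y <- s) ((x i - y%:R) * (x i + 1 + y%:R)))^-1.
  rewrite -!prodfV -!big_split; apply: eq_bigr => y _ /=.
  rewrite -[y%:R - x i]opprB -[y%:R - (x i + 1)]opprB.
  by rewrite invf_div mulf_div mulrN [- _ * (_ + _)]mulNr invrN mulrNN.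
have q2 (s : seq nat) :
  (\prod_(y <- s) ((x i + y%:R) / (x i - y%:R)))
    * (\prod_(y <- s) ((x i + 1 + y%:R) / (x i + 1 - y%:R)))^-1
  = (\prod_(y <- s) ((x i + y%:R) * (x i + 1 - y%:R)))
    * (\prod_(y <- s) ((x i - y%:R) * (x i + 1 + y%:R)))^-1.
  by rewrite -!prodfV -!big_split; apply: eq_bigr => y _ /=; rewrite invf_div mulf_div.
exact: ratio_cancel.
Qed.

Lemma sum_parts : \sum_i x i = (psize mu)%:R.
Proof.
rewrite /psize sumnE (big_nth 0%N) big_mkord natr_sum.
by apply: eq_bigr.
Qed.

(* A forbidden move x -> x + 1 costs nothing in the sums: if x + 1 is also a part,
   then b at x + 1 equals a at x. *)
Lemma residue_eq0 (i : 'I_(size mu)) : ~~ strict (incr_nth mu i) ->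
  residue a b i = 0.
Proof.
have il := ltn_ord i; rewrite strict_incr ?(ltnW il) // negb_or => /andP[i0 gap].
have jl : (i.-1 < size mu)%N by rewrite prednK ?lt0n // ltnW.
have step : (part mu i.+1 < part mu i)%N.
  by move/strictP: mu_strict; apply; rewrite lt0n i0 ltnW.
have E : nth 0%N mu i.-1 = (nth 0%N mu i).+1.
  by move: gap step; rewrite /part /=; lia.
rewrite /residue (bigD1 (Ordinal jl)) //= /a /b /x E -natr1.
by rewrite [X in X * _](_ : _ = 0) ?mul0r //; ring.
Qed.

(** Inserting the part 1 multiplies [Hprod] by all [(1 + y) / (y - 1)], the inverses of [b / a]. *)
Lemma Hprod_ratio_new : strict (incr_nth mu (size mu)) ->
  (Hprod mu)%:R / (Hprod (incr_nth mu (size mu)))%:R = \prod_i (b i / a i).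
Proof.
move=> si; move: (si); rewrite incr_nth_size -cats1 => si'.
rewrite (HprodR_insert si') cats0 big_nil (_ : 1`! = 1)%N // !mulr1.
rewrite invfM mulrA divff ?HprodR_neq0 // mul1r -prodfV (big_nth 0%N) big_mkord.
apply: eq_bigr => i _; rewrite invf_div -/(x i) /b /a.
by have := x_gt0 i => xi; field; rewrite ?gt_eqF // addr_gt0.
Qed.

(** A new row is forbidden only if 1 is already a part, and [b] vanishes at that part. *)
Lemma prod_eq0_new : ~~ strict (incr_nth mu (size mu)) -> \prod_i (b i / a i) = 0.
Proof.
rewrite strict_incr // negb_or => /andP[m0 gap].
have jl : ((size mu).-1 < size mu)%N by rewrite prednK ?lt0n.
have pos : (0 < part mu (size mu))%N by rewrite part_pos // lt0n.
have E : nth 0%N mu (size mu).-1 = 1%N.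
  by move: gap pos; rewrite [part _ _.+1]part_default // /part; lia.
rewrite (bigD1 (Ordinal jl)) //= /a /b /x E.
by rewrite subrr mulr0 !mul0r.
Qed.

(** The one-step weight: the power of 2 is 2 when an existing row grows and 1 when a row is
    opened. *)
Definition up (i : nat) : rat :=
  (if (i < size mu)%N then 2 else 1) * ((Hprod mu)%:R / (Hprod (incr_nth mu i))%:R).

Let up_row (i : 'I_(size mu)) :
  (if strict (incr_nth mu i) then up i else 0) = residue a b i / a i.
Proof.
case: ifP => [si|/negbT nsi]; last by rewrite residue_eq0 ?mul0r.
by rewrite -Hprod_ratio_row // /up ltn_ord.
Qed.

Lemma sum_up : \sum_(0 <= i < (size mu).+1 | strict (incr_nth mu i)) up i = 1.
Proof.
rewrite big_mkcond big_nat_recr //= big_mkord (eq_bigr _ (fun i _ => up_row i)).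
rewrite -(partial_fractions_at0 b a_inj a_neq0) addrC; congr (_ + _).
case: ifP => [si|/negbT nsi]; last by rewrite prod_eq0_new.
by rewrite /up ltnn mul1r Hprod_ratio_new.
Qed.

(** The binomial is [a i / 2] and cancels the denominator of the weight, leaving half the sum of
    residues, where [a i - b i = 2 x i]. *)
Lemma sum_up_binom :
  \sum_(0 <= i < (size mu).+1 | strict (incr_nth mu i))
     up i * ('C((part mu i.+1).+1, 2))%:R = (psize mu)%:R.
Proof.
(* The box of a new row has content 1 and contributes nothing. *)
rewrite big_mkcond big_nat_recr //= [part _ _]part_default // bin_small // mulr0.
rewrite if_same addr0 big_mkord.
transitivity (\sum_i residue a b i / 2).
  apply: eq_bigr => i _.
  have -> : ('C((part mu i.+1).+1, 2))%:R = a i / 2 :> rat.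
    have := bin_ffact (part mu i.+1).+1 2; rewrite ffactSS ffactn1.
    move/(congr1 (fun n => n%:R : rat)); rewrite natrM [in RHS]natrM => Ebin.
    rewrite -[LHS](mulfK (_ : 2 != 0)) // Ebin -[(part mu _).+1%:R]natr1.
    by congr (_ / _); rewrite mulrC.
  rewrite -[RHS]mul1r.
  have := up_row i; case: ifP => _ E; first by rewrite E; field.
  by move/eqP: E; rewrite eq_sym mulf_eq0 invr_eq0 (negPf (a_neq0 i)) orbF
     => /eqP ->; rewrite mul0r mulr0.
rewrite -mulr_suml sum_residues // -sumrB -sum_parts mulr_suml.
by apply: eq_bigr => i _; rewrite /a /b; field.
Qed.

End Ratios.

(** * Summation over strict partitions *)

Lemma leq_sumn s t : (forall i, nth 0 s i <= nth 0 t i)%N -> (sumn s <= sumn t)%N.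
Proof.
elim: s t => [//|x s IH] [|y t] st /=.
  have /IH : (forall i, nth 0 s i <= nth 0 [::] i)%N.
    by move=> i; have := st i.+1; rewrite !nth_nil.
  by have := st 0%N; rewrite /=; lia.
by apply: leq_add; [apply: (st 0%N) | apply: IH => i; apply: (st i.+1)].
Qed.

(** Equal sums force termwise equality; positivity excludes trailing zeros, which [nth] cannot
    detect. *)
Lemma sumn_inj s t : (forall i, nth 0 s i <= nth 0 t i)%N -> sumn s = sumn t ->
  all (fun x => 0 < x)%N s -> all (fun x => 0 < x)%N t -> s = t.
Proof.
elim: s t => [|x s IH] [|y t] //= st e; first by move=> _ /andP[]; lia.
  by move=> /andP[]; lia.
have st' i := st i.+1; have := leq_sumn st'; have := st 0%N; rewrite /= => xy le.
move=> /andP[_ ps] /andP[_ pt].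
by rewrite (IH t) //; [congr (_ :: _)|]; lia.
Qed.

Lemma contains_eq la mu : strict la -> strict mu -> contains la mu ->
  psize la = psize mu -> la = mu.
Proof.
move=> /andP[_ pl] /andP[_ pm] /containsP c e; apply/esym/sumn_inj => // i.
exact: (c i.+1).
Qed.

Lemma contains_refl mu : contains mu mu.
Proof. exact/containsP. Qed.

Lemma contains_incr la mu i : contains la (incr_nth mu i) -> contains la mu.
Proof.
move=> /containsP c; apply/containsP => j j0; apply: leq_trans (c j j0).
by rewrite part_incr // leq_addl.
Qed.

Lemma mem_part_of_set m (A : {set 'I_m.+1}) (x : 'I_m.+1) :
  (val x \in part_of_set A) = (x \in A).
Proof. by rewrite mem_sort mem_map ?mem_enum //; apply: val_inj. Qed.

Lemma part_of_set_sorted m (A : {set 'I_m.+1}) : sorted gtn (part_of_set A).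
Proof.
rewrite gtn_sorted_uniq_geq sort_uniq map_inj_uniq ?enum_uniq //=; last exact: val_inj.
by apply: sort_sorted => x y; apply: leq_total.
Qed.

Lemma part_of_setP mu m (A : {set 'I_m.+1}) : strict mu -> (psize mu <= m)%N ->
  (part_of_set A == mu) = (A == [set x | val x \in mu]).
Proof.
move=> sm mum; apply/eqP/eqP => [<-|->].
  by apply/setP => x; rewrite inE mem_part_of_set.
apply: (irr_sorted_eq (rev_trans ltn_trans) ltnn); first exact: part_of_set_sorted.
  by case/andP: sm.
(* Each part of [mu] is at most [psize mu], so it fits in the range of the encoding. *)
move=> y; have ym : y \in mu -> (y < m.+1)%N.
  move=> ym; rewrite ltnS (leq_trans _ mum) //.
  by rewrite /psize sumnE (big_rem y) //= leq_addr.
apply/idP/idP => [|yin].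
  by rewrite mem_sort => /mapP[x + ->]; rewrite mem_enum inE.
by rewrite -[y]/(val (Ordinal (ym yin))) mem_part_of_set inE.
Qed.

(** * Weights and induction on the number of added boxes *)

Definition weight (la mu : seq nat) : rat :=
  ((2%:Q) ^ ((psize la)%:Z - (size la)%:Z - (psize mu)%:Z + (size mu)%:Z))
  * (nSYT la mu)%:R * (Hprod mu)%:R / (Hprod la)%:R.

(** The total size [m] is separate from [mu], so the index type stays fixed when [mu] gains a
    box. *)
Definition weighted_sum (m : nat) (mu : seq nat) (g : seq nat -> rat) : rat :=
  \sum_(A : {set 'I_m.+1} |
      strict (part_of_set A) && (psize (part_of_set A) == m)
      && contains (part_of_set A) mu)
    weight (part_of_set A) mu * g (part_of_set A).

Lemma weight_id mu : weight mu mu = 1.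
Proof.
rewrite /weight nSYT_id mulr1 mulfK ?HprodR_neq0 //.
by rewrite [X in _ ^ X](_ : _ = 0) //; lia.
Qed.

Lemma weighted_sum_id mu g : strict mu -> weighted_sum (psize mu) mu g = g mu.
Proof.
move=> sm; rewrite /weighted_sum (big_pred1 [set x | val x \in mu]) => [|A /=].
  have /eqP -> : part_of_set [set x : 'I_(psize mu).+1 | val x \in mu] == mu.
    by rewrite part_of_setP.
  by rewrite weight_id mul1r.
rewrite -part_of_setP //; apply/andP/eqP => [[/andP[sA /eqP pA] c]|->].
  exact: contains_eq.
by rewrite sm eqxx contains_refl.
Qed.

Lemma weight_rec la mu : strict la -> strict mu -> contains la mu ->
  (psize mu < psize la)%N ->
  weight la mu = \sum_(0 <= i < (size mu).+1
       | strict (incr_nth mu i) && contains la (incr_nth mu i))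
     up mu i * weight la (incr_nth mu i).
Proof.
move=> sl sm c lt; rewrite {1}/weight nSYT_rec // natr_sum mulr_sumr !mulr_suml.
rewrite [RHS]big_seq_cond [LHS]big_seq_cond; apply: eq_bigr => i /andP[+ _].
rewrite mem_index_iota ltnS => im.
set e := _ - _ + _ : int; rewrite /weight /up psize_incr // size_incr_nth.
have -> : (2 ^ e : rat) = (if (i < size mu)%N then 2 else 1)
   * 2 ^ ((psize la)%:Z - (size la)%:Z - (psize mu).+1%:Z
           + (if (i < size mu)%N then size mu else i.+1)%:Z).
  case: ifP => imu.
    rewrite -[X in X * _]expr1z -expfzDr //; congr (_ ^ _); rewrite /e; lia.
  by rewrite mul1r; congr (_ ^ _); rewrite /e; lia.
move: (_ ^ _) (if _ then 2 else 1) => u v.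
by field; rewrite !HprodR_neq0.
Qed.

(** Expand each weight by its first step, then exchange the sums over the final shape and the added
    box. *)
Lemma weighted_sum_rec m mu g : strict mu -> (psize mu < m)%N ->
  weighted_sum m mu g = \sum_(0 <= i < (size mu).+1 | strict (incr_nth mu i))
     up mu i * weighted_sum m (incr_nth mu i) g.
Proof.
move=> sm lt; rewrite /weighted_sum.
under [RHS]eq_bigr do rewrite mulr_sumr.
rewrite [RHS](exchange_big_dep (fun A : {set 'I_m.+1} =>
   strict (part_of_set A) && (psize (part_of_set A) == m)
      && contains (part_of_set A) mu)) /=; last first.
  by move=> i A _ /andP[-> /contains_incr].
apply: eq_bigr => A /andP[/andP[sA /eqP pA] c].
rewrite weight_rec ?pA // mulr_suml sA eqxx /=.
by apply: eq_bigr => i _; rewrite mulrA.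
Qed.

Lemma eq_weighted_sum m mu g h : g =1 h -> weighted_sum m mu g = weighted_sum m mu h.
Proof. by move=> gh; apply: eq_bigr => A _; rewrite gh. Qed.

Lemma weighted_sum_addc m mu g c :
  weighted_sum m mu (fun la => g la + c)
  = weighted_sum m mu g + c * weighted_sum m mu (fun=> 1).
Proof.
rewrite /weighted_sum mulr_sumr -big_split; apply: eq_bigr => A _ /=; ring.
Qed.

Lemma weighted_sum1 mu n : strict mu -> weighted_sum (psize mu + n) mu (fun=> 1) = 1.
Proof.
elim: n mu => [|n IH] mu sm; first by rewrite addn0 weighted_sum_id.
rewrite weighted_sum_rec //; last lia.
rewrite -[RHS](sum_up sm) big_seq_cond [RHS]big_seq_cond.
apply: eq_bigr => i /andP[]; rewrite mem_index_iota ltnS => im si.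
by rewrite -addSnnS -(psize_incr sm im) IH ?mulr1.
Qed.

Theorem theorem1p3 (mu : seq nat) (n : nat) :
  strict mu ->
  skew_sum mu n = ('C(n, 2) + n * psize mu)%N%:R.
Proof.
move=> sm; transitivity (weighted_sum (psize mu + n) mu
   (fun la => (sum_binom_content la)%:R - (sum_binom_content mu)%:R)).
  by apply: eq_bigr.
elim: n mu sm => [|n IH] mu sm; first by rewrite addn0 weighted_sum_id ?subrr.
rewrite weighted_sum_rec //; last lia.
(* The content sum splits into the added box and the boxes added later; the induction hypothesis
   applies at size [(psize mu).+1]. *)
transitivity (\sum_(0 <= i < (size mu).+1 | strict (incr_nth mu i))
   (up mu i * ('C(n, 2) + n * (psize mu).+1)%N%:R
    + up mu i * 'C((part mu i.+1).+1, 2)%:R)).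
  rewrite big_seq_cond [RHS]big_seq_cond.
  apply: eq_bigr => i /andP[]; rewrite mem_index_iota ltnS => im si.
  rewrite -mulrDr -addSnnS -(psize_incr sm im); congr (_ * _).
  (* The contribution of the added box is constant in [la], and the total weight is 1. *)
  rewrite -IH // -[X in _ + X]mulr1 -[X in _ + _ * X](weighted_sum1 n si).
  rewrite -weighted_sum_addc; apply: eq_weighted_sum => la.
  by rewrite sum_binom_content_incr // natrD; ring.
rewrite big_split /= -mulr_suml sum_up // sum_up_binom // mul1r -natrD.
by congr (_%:R); rewrite binS bin1; lia.
Qed.
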